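(* Let $n\ge 1$ and let $\lambda,\mu$ be partitions of $n$. Let $\lambda^{[1]}=(\lambda_2,\lambda_3,\ldots)$ be $\lambda$ with its first part removed. Then $$X^{\lambda}_{\mu}(t)=\sum_{\substack{\tau\lhd\mu\\ |\tau|\le n-\lambda_1}}\ \sum_{\rho\vdash |\lambda^{[1]}|-|\tau|}\frac{(-1)^{l(\rho)}}{z_\rho(t)}\,X^{\lambda^{[1]}}_{\tau\cup\rho}(t)=\sum_{i=0}^{n-\lambda_1}\ \sum_{\substack{\tau\lhd\mu\\ \tau\vdash i}}\ \sum_{\rho\vdash (n-\lambda_1-i)}\frac{(-1)^{l(\rho)}}{z_\rho(t)}\,X^{\lambda^{[1]}}_{\tau\cup\rho}(t).$$
   Context: Let $V$ be the ring of symmetric functions over $\mathbb Q(t)$, with power sums $p_n$, $p_\lambda=p_{\lambda_1}p_{\lambda_2}\cdots$. For a partition $\lambda$ with $m_i(\lambda)$ parts equal to $i$, put $z_\lambda=\prod_{i\ge1}i^{m_i(\lambda)}m_i(\lambda)!$ and $z_\lambda(t)=z_\lambda/\prod_{i=1}^{l(\lambda)}(1-t^{\lambda_i})$; $l(\lambda)$ is the number of nonzero parts and $|\lambda|$ the weight. Equip $V$ with the bilinear form $\langle p_\lambda,p_\mu\rangle=\delta_{\lambda\mu}z_\lambda(t)$. Define $q_n\in V$ by $\sum_{n\ge0}q_nz^n=\exp\left(\sum_{n\ge1}\frac{1-t^n}{n}p_nz^n\right)$. The Hall-Littlewood functions are $Q_\lambda(t)=\prod_{i<j}\frac{1-R_{ij}}{1-tR_{ij}}\,q_{\lambda_1}\cdots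 q_{\lambda_l}$, where the raising operator $R_{ij}$ raises the $i$-th index by 1 and lowers the $j$-th index by 1, and $P_\lambda(t)=b_\lambda(t)^{-1}Q_\lambda(t)$ with $b_\lambda(t)=\prod_{i\ge1}\prod_{j=1}^{m_i(\lambda)}(1-t^j)$; one has $\langle P_\lambda,Q_\mu\rangle=\delta_{\lambda\mu}$. The Green polynomials $X^\lambda_\mu(t)$ are defined by $p_\mu=\sum_\lambda X^\lambda_\mu(t)P_\lambda(t)$; equivalently $X^\lambda_\mu(t)=\langle Q_\lambda(t),p_\mu\rangle$; in particular $X^{\emptyset}_{\emptyset}=1$. A subpartition $\tau\lhd\mu$ of $\mu=(\mu_1,\ldots,\mu_l)$ is $\tau=(\mu_{i_1},\ldots,\mu_{i_s})$ for some $1\le i_1<\cdots<i_s\le l$ (possibly $\emptyset$ or $\mu$). Sums over $\tau\lhd\mu$ run over the $2^{l(\mu)}$ index subsets, i.e. subpartitions are counted with multiplicity. $\tau\cup\rho$ is the partition whose parts are all the parts of $\tau$ and $\rho$ together. *)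

(* Defs.v *)
From HB Require Import structures.
From mathcomp Require Import all_boot all_order all_fingroup all_algebra.
From mathcomp Require Import boolp.
From mathcomp.multinomials Require Import mpoly.

Set Implicit Arguments.
Unset Strict Implicit.
Unset Printing Implicit Defensive.

Import GRing.Theory.

Local Open Scope ring_scope.

Notation Qt := {fraction {poly rat}}.
Definition t : Qt := tofrac 'X.

Definition mpolyseq := forall n : nat, {mpoly Qt[n]}.
HB.instance Definition _ := Choice.copy mpolyseq (forall n : nat, {mpoly Qt[n]}).

Section MpolyseqRing.
Implicit Types f g h : mpolyseq.

Definition ms0 : mpolyseq := fun=> 0.
Definition ms1 : mpolyseq := fun=> 1.
Definition msopp f : mpolyseq := fun n => - f n.
Definition msadd f g : mpolyseq := fun n => f n + g n.
Definition msmul f g : mpolyseq := fun n => f n * g n.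
Definition msscale (a : Qt) f : mpolyseq := fun n => a *: f n.

Fact msaddA : associative msadd.
Proof. by move=> f g h; apply: functional_extensionality_dep => n; exact: addrA. Qed.
Fact msaddC : commutative msadd.
Proof. by move=> f g; apply: functional_extensionality_dep => n; exact: addrC. Qed.
Fact msadd0 : left_id ms0 msadd.
Proof. by move=> f; apply: functional_extensionality_dep => n; exact: add0r. Qed.
Fact msaddN : left_inverse ms0 msopp msadd.
Proof. by move=> f; apply: functional_extensionality_dep => n; exact: addNr. Qed.
HB.instance Definition _ :=
  GRing.isZmodule.Build mpolyseq msaddA msaddC msadd0 msaddN.

Fact msmulA : associative msmul.
Proof. by move=> f g h; apply: functional_extensionality_dep => n; exact: mulrA. Qed.
Fact msmulC : commutative msmul.
Proof. by move=> f g; apply: functional_extensionality_dep => n; exact: mulrC. Qed.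
Fact msmul1 : left_id ms1 msmul.
Proof. by move=> f; apply: functional_extensionality_dep => n; exact: mul1r. Qed.
Fact msmulDl : left_distributive msmul +%R.
Proof. by move=> f g h; apply: functional_extensionality_dep => n; exact: mulrDl. Qed.
Fact ms1_neq0 : ms1 != 0.
Proof. by apply/eqP => /(congr1 (fun f : mpolyseq => f 0)) /eqP; rewrite oner_eq0. Qed.
HB.instance Definition _ := GRing.Zmodule_isComNzRing.Build mpolyseq
  msmulA msmulC msmul1 msmulDl ms1_neq0.

Fact msscaleA a b f : msscale a (msscale b f) = msscale (a * b) f.
Proof. by apply: functional_extensionality_dep => n; exact: scalerA. Qed.
Fact msscale1 : left_id 1 msscale.
Proof. by move=> f; apply: functional_extensionality_dep => n; exact: scale1r. Qed.
Fact msscaleDr : right_distributive msscale +%R.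
Proof. by move=> a f g; apply: functional_extensionality_dep => n; exact: scalerDr. Qed.
Fact msscaleDl f : {morph msscale^~ f : a b / a + b}.
Proof. by move=> a b; apply: functional_extensionality_dep => n; exact: scalerDl. Qed.
HB.instance Definition _ := GRing.Zmodule_isLmodule.Build Qt mpolyseq
  msscaleA msscale1 msscaleDr msscaleDl.

Fact msscaleAl a f g : a *: (f * g) = (a *: f) * g.
Proof. by apply: functional_extensionality_dep => n; exact: scalerAl. Qed.
HB.instance Definition _ := GRing.Lmodule_isLalgebra.Build Qt mpolyseq msscaleAl.
HB.instance Definition _ := GRing.Lalgebra_isComAlgebra.Build Qt mpolyseq.

Lemma mpolyseqP f g : (forall n, f n = g n) <-> f = g.
Proof. by split=> [|->//]; apply: functional_extensionality_dep. Qed.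
End MpolyseqRing.

(* Sets the last variable to 0: the transition map of the inverse limit. *)
Definition last0 n (p : {mpoly Qt[n.+1]}) : {mpoly Qt[n]} :=
  p \mPo [tuple oapp (fun j : 'I_n => 'X_j) 0 (unlift ord_max i) | i < n.+1].

(* A symmetric function is a compatible sequence of symmetric polynomials      *)
(* f n in n variables whose degrees are bounded (msize is 1 + degree).         *)
Definition symfun_spec (f : mpolyseq) : Prop :=
  [/\ forall n, f n \is symmetric,
      forall n, last0 (f n.+1) = f n
    & exists d, forall n, (msize (f n) <= d)%N].

Definition symfun_pred : {pred mpolyseq} := fun f => `[< symfun_spec f >].

Fact symfun_subalg : subalg_closed symfun_pred.
Proof.
split=> [|a f g /asboolP[fs fl [d fd]] /asboolP[gs gl [e ge]]
         |f g /asboolP[fs fl [d fd]] /asboolP[gs gl [e ge]]]; apply/asboolP.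
- split=> [n|n|]; first exact: rpred1.
    exact: comp_mpoly1.
  by exists 1%N => n; rewrite msize1.
- split=> [n|n|].
  + by apply: (rpredD (rpredZ a (fs n)) (gs n)).
  + transitivity (a *: last0 (f n.+1) + last0 (g n.+1)); first exact: linearP.
    by rewrite fl gl.
  + exists (maxn d e) => n; apply: leq_trans (msizeD_le _ _) _.
    rewrite geq_max !leq_max ge orbT andbT.
    by rewrite (leq_trans (msizeZ_le _ _)).
- split=> [n|n|]; first exact: (rpredM (fs n) (gs n)).
    change (last0 (f n.+1 * g n.+1) = f n * g n).
    by rewrite -[f n]fl -[g n]gl /last0 rmorphM.
  exists (d + e).+1 => n; apply: leq_trans (msizeM_le _ _) _.
  by rewrite ltnS leq_add.
Qed.
HB.instance Definition _ :=
  GRing.isSubalgClosed.Build Qt mpolyseq symfun_pred symfun_subalg.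

Record symfun := SymFun { sfval :> mpolyseq; _ : sfval \in symfun_pred }.
HB.instance Definition _ := [isSub for sfval].
HB.instance Definition _ := [Choice of symfun by <:].
HB.instance Definition _ := [SubChoice_isSubComNzRing of symfun by <:].
HB.instance Definition _ := [SubZmodule_isSubLmodule of symfun by <:].
HB.instance Definition _ := [SubNzRing_SubLmodule_isSubLalgebra of symfun by <:].
HB.instance Definition _ := [SubLalgebra_isSubAlgebra of symfun by <:].

Definition psum_seq (k : nat) : mpolyseq := fun n => \sum_(i < n) 'X_i ^+ k.

Fact psum_subproof k : psum_seq k.+1 \in symfun_pred.
Proof.
apply/asboolP; split=> [n|n|].
- apply/issymP => s; rewrite /psum_seq raddf_sum /=.
  rewrite [RHS](reindex_inj (@perm_inj _ s)) /=; apply: eq_bigr => i _.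
  by rewrite rmorphXn /= /msym mmapX mmap1U.
- rewrite /psum_seq /last0 raddf_sum big_ord_recr /= [X in _ + X]rmorphXn /=.
  rewrite comp_mpolyXU -tnth_nth tnth_mktuple unlift_none /= expr0n addr0.
  apply: eq_bigr => i _; rewrite rmorphXn /= comp_mpolyXU -tnth_nth tnth_mktuple.
  have -> : widen_ord (leqnSn n) i = lift ord_max i.
    by apply: val_inj; rewrite /= /bump leqNgt ltn_ord.
  by rewrite liftK.
- exists k.+2 => n; apply: (leq_trans (msize_sum _ _ _)).
  apply/bigmax_leqP_seq => i _ _.
  by rewrite mpolyXn msizeX mdegMn mdeg1 mul1n.
Qed.

(* The power sum p_k, for k > 0; the value at k = 0 is irrelevant. *)
Definition psum (k : nat) : symfun :=
  if k is k'.+1 then SymFun (psum_subproof k') else 1.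

Definition ppart (la : seq nat) : symfun := \prod_(k <- la) psum k.

Definition is_part (la : seq nat) : bool := sorted geq la && (0%N \notin la).

Definition is_part_of (n : nat) (la : seq nat) : bool :=
  is_part la && (sumn la == n).

Definition partns (n : nat) : seq (seq nat) :=
  [seq map val (s : seq 'I_n.+1)
     | s : {bseq n of 'I_n.+1} in [pred s : {bseq n of 'I_n.+1}
                                     | is_part_of n (map val s)]].

Lemma mem_partns n la : (la \in partns n) = is_part_of n la.
Proof.
apply/imageP/idP => [[s + ->]|/[dup] hla]; first by rewrite inE.
move=> /andP[/andP[_ la0] /eqP hn].
have sz : (size la <= n)%N.
  rewrite -hn; elim: la la0 {hla hn} => //= a la IH.
  rewrite inE negb_or eq_sym -lt0n => /andP[a0 /IH h].
  by rewrite -add1n leq_add.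
have le x : x \in la -> (x < n.+1)%N.
  rewrite ltnS -hn => xla; rewrite sumnE (big_rem _ xla) /=; exact: leq_addr.
have eqla : map val (map (@inord n) la) = la.
  rewrite -map_comp -[RHS]map_id; apply/eq_in_map => x /le xn /=.
  exact: inordK.
have szs : (size (map (@inord n) la) <= n)%N by rewrite size_map.
by exists (Bseq szs); rewrite ?inE eqla.
Qed.

Lemma partns_uniq n : uniq (partns n).
Proof.
rewrite map_inj_uniq ?enum_uniq // => s1 s2 /(inj_map val_inj) ?.
exact: val_inj.
Qed.

Definition zpart (la : seq nat) : nat :=
  \prod_(i <- undup la) (i ^ count_mem i la * (count_mem i la)`!)%N.

Definition zt (la : seq nat) : Qt :=
  (zpart la)%:R / \prod_(k <- la) (1 - t ^+ k).

Definition is_hall_form (B : {biscalar symfun}) : Prop :=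
  forall la mu, is_part la -> is_part mu ->
    B (ppart la) (ppart mu) = if la == mu then zt la else 0.

(* q_n is the coefficient of z^n in exp(S(z)) = \sum_k S(z)^k / k!, where      *)
(* S(z) = \sum_(k >= 1) (1 - t^k) / k p_k z^k. As S has no constant term, only *)
(* the powers S^k with k <= n and the terms of S of degree <= n contribute.    *)
Definition qlog (n : nat) : {poly symfun} :=
  \sum_(1 <= k < n.+1) (((1 - t ^+ k) / k%:R) *: psum k) *: 'X^k.

Definition qfun (n : nat) : symfun :=
  \sum_(k < n.+1) (k`!%:R^-1 : Qt) *: (qlog n ^+ k)`_n.

Definition qint (a : int) : symfun := if a is Posz n then qfun n else 0.

Section Raising.
Variable l : nat.
Implicit Types (i j : 'I_l) (a : 'I_l -> int) (g : ('I_l -> int) -> symfun).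

Definition qprod a : symfun := \prod_(i < l) qint (a i).

Definition raise i j a : 'I_l -> int :=
  fun k => a k + (k == i)%:Z - (k == j)%:Z.

(* (1 - R_ij) / (1 - t R_ij) = 1 + \sum_(k >= 1) (t^k - t^(k-1)) R_ij^k,       *)
(* truncated after R_ij^N, acting on families g of symmetric functions indexed *)
(* by integer vectors.                                                         *)
Definition raise_factor (N : nat) i j g : ('I_l -> int) -> symfun :=
  fun a => g a + \sum_(1 <= k < N.+1)
                   (t ^+ k - t ^+ k.-1) *: g (iter k (raise i j) a).

Definition raise_prod (N : nat) g : ('I_l -> int) -> symfun :=
  foldr (fun ij g' => raise_factor N ij.1 ij.2 g') g
        [seq ij : 'I_l * 'I_l <- enum {: 'I_l * 'I_l} | (ij.1 < ij.2)%N].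
End Raising.

(* The Hall-Littlewood function Q_la. Truncation at N = |la| loses nothing:    *)
(* if R_ij occurs k times, the indices from the j-th on sum to at most         *)
(* |la| - k, so that for k > |la| one of them is negative and the product of   *)
(* the q's vanishes, q_n being 0 for n < 0. The factors commute.               *)
Definition HLQ (la : seq nat) : symfun :=
  raise_prod (sumn la) (@qprod (size la)) (fun i => (nth 0%N la i)%:Z).

(* The Green polynomial X^la_mu(t) = <Q_la, p_mu>, i.e. the coefficient of     *)
(* P_la in p_mu, the basis (P_la) being dual to (Q_la).                        *)
Definition green (B : {biscalar symfun}) (la mu : seq nat) : Qt :=
  B (HLQ la) (ppart mu).

Definition part_union (la mu : seq nat) : seq nat := sort geq (la ++ mu).

(* Main.v *)
Require Import Defs.
From HB Require Import structures.
From mathcomp Require Import all_boot all_order all_fingroup all_algebra.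
From mathcomp Require Import zify boolp.
From mathcomp.multinomials Require Import mpoly.

Set Implicit Arguments.
Unset Strict Implicit.
Unset Printing Implicit Defensive.

Import Order.TTheory GRing.Theory Num.Theory.

Local Open Scope ring_scope.

(** Put q(w) = sum_n q_n w^n.  On polynomials in the power sums the Hall form
makes multiplication by p_k adjoint to k / (1 - t^k) d/dp_k.  As q(w) is the
exponential of sum_k (1 - t^k) / k p_k w^k, multiplication by q(w) is adjoint to
the exponential of sum_k w^k d/dp_k, which is the translation
p_k |-> p_k + w^k.  It sends p_mu to prod_i (p_(mu_i) + w^(mu_i)), so the adjoint
of q_a sends p_mu to the sum of the p_tau over the subpartitions tau of mu with
|mu| - |tau| = a ([hall_qfun], [coef_skew_gen_mask]).

Let E_s be the sum of (-1)^(l(rho)) / z_rho(t) p_rho over the partitions rho of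
s.  Then sum_s E_s z^s = 1 / q(z), and the translation multiplies this series by
exp (- sum_k (1 - t^k) / k (w z)^k) = (1 - w z) / (1 - t w z)
([sum_qinv_coef_skew_gen]).  This is the series of a raising operator, with
R = w z.  Moving the factors of q_(a_2) ... q_(a_l) one by one across the form
therefore shows that multiplying the right-hand argument by E_s amounts to
keeping, on the left, the terms of degree s of the factors
(1 - R_1j) / (1 - t R_1j), each R_1j lowering the index a_j
([hall_prod_shift]).  These are the terms that raise the first index by s.

The raising operators commute, so the R_ij with 1 < i < j may be applied last;
they act linearly and do not touch the first index.  With m the first part of
lambda and lambda' the rest, this gives
  <Q_lambda, p_mu> = sum_s <Q_lambda', (q_(m+s)^* p_mu) E_s>,
where q_a^* is the adjoint of q_a.  The value of s is |lambda'| - |tau| on the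
term p_tau of q_(m+s)^* p_mu, which is the claimed formula ([green_cons]).

Two points are technical.  Identities between series are reduced to the
recurrence n u_n = sum_i d_i u_(n-i), which says that u is the exponential of
sum_i d_i / i z^i and determines u from d.  And the raising operators are
truncated after |lambda| steps in Q_lambda but after |lambda'| steps in Q_lambda';
the terms in between vanish because a raising operator never increases a tail
sum a_j + ... + a_l, and a negative tail sum forces a negative index. *)

(** * Series determined by a logarithmic derivative *)

Section Convolution.
Variable A : comNzRingType.
Implicit Types (u v w d e : nat -> A) (n : nat).

Definition conv u v n : A := \sum_(i < n.+1) u i * v (n - i)%N.

Lemma coef_conv N u v n : (n < N)%N ->
  (\poly_(i < N) u i * \poly_(i < N) v i)`_n = conv u v n.
Proof.
move=> nN; rewrite coefM; apply: eq_bigr => i _; rewrite !coef_poly.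
by rewrite (leq_ltn_trans (leq_ord i) nN) (leq_ltn_trans (leq_subr i n) nN).
Qed.

Lemma eq_conv u u' v v' n :
  (forall i, (i <= n)%N -> u i = u' i) -> (forall i, (i <= n)%N -> v i = v' i) ->
  conv u v n = conv u' v' n.
Proof.
move=> uu' vv'; apply: eq_bigr => i _.
by rewrite uu' ?leq_ord // vv' ?leq_subr.
Qed.

Lemma convC u v n : conv u v n = conv v u n.
Proof. by rewrite -!(@coef_conv n.+1) // mulrC. Qed.

(** Convolution is the product of power series, and its value at n only involves
the coefficients up to n: associativity is inherited from polynomials truncated
above degree n. *)
Lemma convA u v w n : conv u (conv v w) n = conv (conv u v) w n.
Proof.
set N := n.+1; pose P x := \poly_(i < N) x i : {poly A}.
transitivity ((P u * (P v * P w))`_n).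
  rewrite coefM; apply: eq_bigr => i _; rewrite coef_poly ltn_ord.
  by rewrite coef_conv // ltnS leq_subr.
rewrite mulrA coefM; apply: eq_bigr => i _.
by rewrite coef_conv // coef_poly ltnS leq_subr.
Qed.

Lemma convDl u v w n : conv (fun i => u i + v i) w n = conv u w n + conv v w n.
Proof. by rewrite -big_split; apply: eq_bigr => i _; rewrite mulrDl. Qed.

(** The Leibniz rule for the derivation z d/dz. *)
Lemma euler_conv u v n :
  n%:R * conv u v n =
    conv (fun i => i%:R * u i) v n + conv u (fun i => i%:R * v i) n.
Proof.
rewrite -big_split mulr_sumr; apply: eq_bigr => i _ /=.
have {1}-> : n = (i + (n - i))%N by rewrite subnKC // leq_ord.
by rewrite natrD mulrDl -mulrA (mulrCA (u i)).
Qed.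

(** In terms of generating series, z u'(z) = d(z) u(z) with u(0) = 1: the series
u is the exponential of the sum of the d_i / i z^i. *)
Definition is_exp d u : Prop :=
  u 0%N = 1 /\ forall n, n%:R * u n = conv d u n.

(** The exponential of a sum is a product: both sides of the recurrence obey the
Leibniz rule. *)
Lemma is_exp_conv d e u v :
  is_exp d u -> is_exp e v -> is_exp (fun i => d i + e i) (conv u v).
Proof.
move=> [u0 du] [v0 ev]; split=> [|n].
  by rewrite /conv big_ord1 u0 v0 mulr1.
rewrite euler_conv convDl; congr (_ + _).
  by rewrite convA; apply: eq_conv => // i _; rewrite du.
by rewrite [RHS]convC -convA; apply: eq_conv => // i _; rewrite ev convC.
Qed.

Lemma is_exp_uniq d u v : (forall n, GRing.lreg (n.+1%:R : A)) ->
  d 0%N = 0 -> is_exp d u -> is_exp d v -> u =1 v.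
Proof.
move=> reg d0 [u0 du] [v0 dv]; elim/ltn_ind => -[|n] IH; first by rewrite u0.
apply: (reg n); rewrite du dv; apply: eq_bigr => -[[|i] /= lti] _.
  by rewrite d0 !mul0r.
by rewrite IH // subSS ltnS leq_subr.
Qed.

(** Substitution of x z for z. *)
Lemma is_exp_powers d u x :
  is_exp d u -> is_exp (fun i => d i * x ^+ i) (fun i => u i * x ^+ i).
Proof.
move=> [u0 du]; split=> [|n]; first by rewrite u0 mulr1.
rewrite mulrA du mulr_suml; apply: eq_bigr => i _.
by rewrite mulrACA -exprD subnKC // leq_ord.
Qed.
End Convolution.

Lemma is_exp_rmorph (A A' : comNzRingType) (f : {rmorphism A -> A'})
    (d u : nat -> A) : is_exp d u -> is_exp (f \o d) (f \o u).
Proof.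
move=> [u0 du]; split=> [|n]; first by rewrite /= u0 rmorph1.
rewrite /= -(rmorph_nat f) -rmorphM du rmorph_sum.
by apply: eq_bigr => i _; rewrite rmorphM.
Qed.

Section ExpSeries.
Variables (F : fieldType) (A : comAlgType F).
Variables (ell : nat -> A) (L : nat -> {poly A}).
Hypothesis natF : forall n, n.+1%:R != 0 :> F.
Hypothesis ell0 : ell 0%N = 0.
Hypothesis coefL : forall N i, (i <= N)%N -> (L N)`_i = ell i.

Lemma coef_exp_trunc N k m : (m <= N)%N -> (L N ^+ k)`_m = (L m ^+ k)`_m.
Proof.
suff H M M' j : (j <= M)%N -> (j <= M')%N -> (L M ^+ k)`_j = (L M' ^+ k)`_j.
  by move=> mN; apply: H.
elim: k j => [|k IH] j jM jM' //.
rewrite !exprS !coefM; apply: eq_bigr => -[i /= ij] _.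
rewrite !coefL ?(leq_trans _ jM) ?(leq_trans _ jM') //.
by rewrite IH // (leq_trans (leq_subr _ _)).
Qed.

Lemma coef_exp_small N k m : (m < k)%N -> (m <= N)%N -> (L N ^+ k)`_m = 0.
Proof.
elim: k m => [//|k IH] m; rewrite ltnS => mk mN.
rewrite exprS coefM big1 // => -[[|i] /= im] _.
  by rewrite coefL // ell0 mul0r.
rewrite IH ?mulr0 //; last by rewrite (leq_trans (leq_subr _ _)).
by rewrite (leq_trans _ mk) // ltn_subrL /= (leq_ltn_trans (leq0n i) im).
Qed.

(** The coefficient of z^n in the exponential of the series ell, in which only the
powers up to n contribute. *)
Definition exp_coef n : A :=
  \sum_(k < n.+1) (k`!%:R^-1 : F) *: (L n ^+ k)`_n.

(** Both the order of truncation of the series and the range of the exponents may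
be enlarged, so that one pair of bounds serves for all coefficients at once. *)
Lemma exp_coefE N M n : (n <= N)%N -> (n <= M)%N ->
  exp_coef n = \sum_(k < N.+1) (k`!%:R^-1 : F) *: (L M ^+ k)`_n.
Proof.
move=> nN nM; rewrite /exp_coef.
rewrite (big_ord_widen N.+1 (fun k => (k`!%:R^-1 : F) *: (L n ^+ k)`_n)) //.
rewrite big_mkcond; apply: eq_bigr => k _ /=.
rewrite ltnS; case: leqP => [_|nk]; first by rewrite (coef_exp_trunc k nM).
by rewrite coef_exp_small ?scaler0.
Qed.

(** From (L^(k+1))' = (k+1) L^k L', divided by (k+1)! and summed over k. *)
Lemma is_exp_exp_coef : is_exp (fun i => i%:R * ell i) exp_coef.
Proof.
split=> [|n]; first by rewrite /exp_coef big_ord1 expr0 coefC eqxx invr1 scale1r.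
case: n => [|n].
  by rewrite mul0r /conv big_ord1 /= mul0r mul0r.
set m := n.+1.
have coefD k : m%:R * (L m ^+ k.+1)`_m =
    k.+1%:R * conv (fun i => i%:R * ell i) (fun i => (L m ^+ k)`_i) m.
  (* Multiplication of the m-th coefficient by m is the derivation X d/dX. *)
  have -> : m%:R * (L m ^+ k.+1)`_m = ('X * (L m ^+ k.+1)^`())`_m.
    by rewrite coefXM /= coef_deriv mulr_natl.
  rewrite deriv_exp /= mulrnAr coefMn mulr_natl; congr (_ *+ _).
  rewrite mulrA coefM; apply: eq_bigr => -[i /= im] _.
  by rewrite coefXM; case: i im => [|i] im /=;
    rewrite ?mul0r // coef_deriv coefL // mulr_natl.
rewrite {1}/exp_coef mulr_sumr big_ord_recl /= expr0 coefC /= scaler0 mulr0 add0r.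
transitivity (\sum_(k < m) (k`!%:R^-1 : F) *:
   conv (fun i => i%:R * ell i) (fun i => (L m ^+ k)`_i) m).
  apply: eq_bigr => k _; rewrite -scalerAr coefD mulr_natl -scaler_nat scalerA.
  congr (_ *: _); rewrite /bump /= add1n factS natrM invfM mulrAC mulVf ?mul1r //.
rewrite /conv; under eq_bigr => k _ do rewrite scaler_sumr.
rewrite exchange_big /=; apply: eq_bigr => -[[|i] /= im] _.
  by rewrite !mul0r big1 // => k _; rewrite mul0r scaler0.
rewrite (@exp_coefE n m) ?leq_subr ?leq_subr //; last by rewrite /m subSS leq_subr.
by rewrite mulr_sumr; apply: eq_bigr => k _; rewrite scalerAr.
Qed.
End ExpSeries.

(** * Sums over partitions *)

Lemma Qt_natr_eq0 n : ((n%:R : Qt) == 0) = (n == 0%N).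
Proof.
rewrite -(rmorph_nat (@tofrac {poly rat})) tofrac_eq0 -polyC_natr polyC_eq0.
by rewrite pnatr_eq0.
Qed.

Lemma Qt_natr_neq0 n : (n.+1%:R : Qt) != 0.
Proof. by rewrite Qt_natr_eq0. Qed.

Lemma subr1tX_neq0 k : (0 < k)%N -> 1 - t ^+ k != 0.
Proof.
move=> k_gt0; rewrite subr_eq0 eq_sym -tofracXn -tofrac1 tofrac_eq.
by apply: contraTneq k_gt0 => /(congr1 (fun p : {poly rat} => size p)) /eqP;
  rewrite size_polyXn size_poly1 eqSS => /eqP ->.
Qed.

Lemma geq_total : total geq.
Proof. by move=> m n; apply: leq_total. Qed.

Lemma geq_trans : transitive geq.
Proof. by move=> n m p mn np; apply: leq_trans np mn. Qed.

Lemma geq_anti : antisymmetric geq.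
Proof. by move=> m n; rewrite andbC => /anti_leq. Qed.

Lemma is_part_sort (s : seq nat) : is_part (sort geq s) = (0%N \notin s).
Proof. by rewrite /is_part sort_sorted ?mem_sort //; apply: geq_total. Qed.

Lemma is_part_perm_eq (la mu : seq nat) :
  is_part la -> is_part mu -> perm_eq la mu = (la == mu).
Proof.
move=> /andP[sla _] /andP[smu _]; apply/idP/eqP => [|->]; last exact: perm_refl.
exact: sorted_eq geq_trans geq_anti _ _ sla smu.
Qed.

(** An index that is not a part contributes i^0 0! = 1, so the product may be taken
over any list that contains the parts; this allows two partitions to be compared
over a common list. *)
Lemma zpartE (s la : seq nat) : uniq s -> {subset la <= s} ->
  zpart la = (\prod_(i <- s) (i ^ count_mem i la * (count_mem i la)`!))%N.
Proof.
move=> us sub; rewrite /zpart.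
have ps : perm_eq (undup la) [seq i <- s | i \in la].
  apply: uniq_perm; rewrite ?undup_uniq ?filter_uniq // => i.
  by rewrite mem_undup mem_filter andb_idr //; apply: sub.
rewrite (perm_big _ ps) big_filter big_mkcond; apply: eq_bigr => i _ /=.
by case: ifPn => // /count_memPn ->.
Qed.

(** Adding a part k multiplies k^m m! by k (m + 1), where m is the multiplicity of
k. *)
Lemma zpart_cons k la :
  zpart (k :: la) = (k * (count_mem k la).+1 * zpart la)%N.
Proof.
set s := undup (k :: la).
have us : uniq s by apply: undup_uniq.
have ks : k \in s by rewrite mem_undup mem_head.
rewrite (@zpartE s (k :: la)) //; last by move=> i; rewrite mem_undup.
rewrite (@zpartE s la) //; last by move=> i il; rewrite mem_undup inE il orbT.
rewrite !(bigD1_seq k) //= eqxx add1n expnS factS.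
rewrite [X in (_ * X)%N = _](eq_bigr (fun i : nat =>
    i ^ count_mem i la * (count_mem i la)`!)%N).
  by rewrite -!mulnA; congr (_ * _)%N; rewrite mulnCA.
by move=> i /negPf ik; rewrite eq_sym ik.
Qed.

Lemma zt_cons k la :
  zt (k :: la) = k%:R * (count_mem k la).+1%:R / (1 - t ^+ k) * zt la.
Proof. by rewrite /zt zpart_cons !natrM big_cons invfM mulrACA. Qed.

Lemma zt_perm la mu : perm_eq la mu -> zt la = zt mu.
Proof.
move=> lamu; rewrite /zt (perm_big _ lamu); congr (_%:R / _).
rewrite (@zpartE (undup la) la) ?undup_uniq //; last by move=> i; rewrite mem_undup.
rewrite (@zpartE (undup la) mu) ?undup_uniq //.
  by apply: eq_bigr => i _; rewrite (seq.permP lamu).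
by move=> i; rewrite mem_undup (perm_mem lamu).
Qed.

(** The coefficient of p_rho in 1 / q(z). *)
Definition qinv_coef (rho : seq nat) : Qt := (-1) ^+ size rho / zt rho.

Lemma qinv_coef_perm la mu : perm_eq la mu -> qinv_coef la = qinv_coef mu.
Proof. by move=> h; rewrite /qinv_coef (perm_size h) (zt_perm h). Qed.

(** The effect of removing one part k.  With the multiplicity of k on the left,
it is the form in which z d/dz acts on a sum over partitions. *)
Lemma qinv_coef_cons k la : (0 < k)%N -> 0%N \notin la ->
  (k * (count_mem k la).+1)%:R * qinv_coef (k :: la) = (t ^+ k - 1) * qinv_coef la.
Proof.
move=> k_gt0 la0; rewrite /qinv_coef zt_cons /= exprS invfM invf_div natrM.
set c := k%:R * _; have c0 : c != 0.
  by apply: mulf_neq0 (Qt_natr_neq0 _); rewrite Qt_natr_eq0 -lt0n.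
rewrite -[t ^+ k - 1]opprB mulN1r !(mulNr, mulrN); congr (- _).
by rewrite mulrCA (mulrA c) (mulrCA c) (mulfV c0) mulr1 mulrCA.
Qed.

Lemma sumn_count (s : seq nat) n : sumn s = n ->
  n = (\sum_(i < n.+1) i * count_mem (i : nat) s)%N.
Proof.
move=> sn.
have le i : i \in s -> (i < n.+1)%N.
  by rewrite ltnS -sn => si; rewrite sumnE (big_rem _ si) leq_addr.
rewrite -{1}sn; elim: s {sn} le => [|x s IH] le.
  by rewrite /= big1 // => i _; rewrite muln0.
rewrite /= IH => [|i si]; last by rewrite le // inE si orbT.
have xn := le x (mem_head _ _).
under [RHS]eq_bigr do rewrite mulnDr.
rewrite big_split /=; congr (_ + _)%N.
rewrite (bigD1 (Ordinal xn)) //= eqxx muln1 big1 ?addn0 // => i ix.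
by rewrite eq_sym -(inj_eq val_inj) /= in ix; rewrite (negPf ix) muln0.
Qed.

(** Removing one part k is a bijection from the partitions of n that have such a
part onto all partitions of n - k. *)
Lemma perm_partns_ins n k : (0 < k <= n)%N ->
  perm_eq [seq rho <- partns n | k \in rho]
          [seq sort geq (k :: rho) | rho <- partns (n - k)].
Proof.
move=> /andP[k_gt0 kn]; apply: uniq_perm.
- by rewrite filter_uniq ?partns_uniq.
- rewrite map_inj_in_uniq ?partns_uniq // => la mu.
  rewrite !mem_partns => /andP[pla _] /andP[pmu _] /(congr1 (perm_eq^~ (k :: mu))).
  rewrite !(perm_sort geq (k :: _)) perm_refl perm_cons is_part_perm_eq //.
  by move=> /eqP.
move=> la; rewrite mem_filter mem_partns; apply/andP/mapP.
  move=> [kla /andP[/andP[sla la0] /eqP sumla]]; exists (rem k la).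
    rewrite mem_partns /is_part_of /is_part.
    rewrite (subseq_sorted geq_trans (rem_subseq k la) sla) /=.
    rewrite (contra (@mem_rem _ k la _)) //=.
    by rewrite -sumla !sumnE [in X in _ == X](big_rem _ kla) /= addKn.
  apply: (sorted_eq geq_trans geq_anti sla); first exact: (sort_sorted geq_total).
  by rewrite perm_sym perm_sort perm_sym perm_to_rem.
move=> [mu + ->]; rewrite mem_partns => /andP[/andP[smu mu0] /eqP summu].
rewrite mem_sort mem_head /is_part_of is_part_sort inE negb_or mu0.
rewrite eq_sym -lt0n k_gt0 /=; split=> //.
rewrite !sumnE (perm_big _ (permEl (perm_sort _ _))) big_cons -sumnE summu.
by rewrite /= subnKC.
Qed.

Lemma partns0 : perm_eq (partns 0) [:: [::]].
Proof.
apply: uniq_perm; rewrite ?partns_uniq // => -[|k la].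
  by rewrite mem_partns.
rewrite mem_partns !inE /= /is_part_of /is_part inE negb_or eq_sym -lt0n /=.
by case: k => [|k]; rewrite ?andbF.
Qed.

Lemma qinv_coef0 : qinv_coef [::] = 1.
Proof. by rewrite /qinv_coef /zt /zpart !big_nil invr1 mulr1 invr1 expr0 mulr1. Qed.

Section PartitionSum.
Variables (A : comNzRingType) (phi : {rmorphism Qt -> A}) (x : nat -> A).

Definition part_sum n : A :=
  \sum_(rho <- partns n) phi (qinv_coef rho) * \prod_(k <- rho) x k.

(** Multiply by n = |rho|, written as the sum of i times the multiplicity of i in
rho, and remove one part i from rho.  The series is thus the exponential of
- sum_i (1 - t^i) / i x_i z^i. *)
Lemma is_exp_part_sum : is_exp (fun i => phi (t ^+ i - 1) * x i) part_sum.
Proof.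
split=> [|n].
  by rewrite /part_sum (perm_big _ partns0) big_seq1 big_nil mulr1 qinv_coef0 rmorph1.
pose T rho := phi (qinv_coef rho) * \prod_(k <- rho) x k.
have Tp la mu : perm_eq la mu -> T la = T mu.
  by move=> h; rewrite /T (qinv_coef_perm h) (perm_big _ h).
transitivity (\sum_(i < n.+1) \sum_(rho <- partns n)
    (i * count_mem (i : nat) rho)%:R * T rho).
  rewrite exchange_big /= mulr_sumr !big_seq; apply: eq_bigr => rho.
  rewrite mem_partns => /andP[_ /eqP /sumn_count {1}->].
  by rewrite natr_sum mulr_suml.
apply: eq_bigr => -[[|k] /= kn] _.
  rewrite big1 => [|rho _]; last by rewrite mul0n mul0r.
  by rewrite subrr rmorph0 !mul0r.
transitivity (\sum_(rho <- [seq rho <- partns n | k.+1 \in rho])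
    (k.+1 * count_mem k.+1 rho)%:R * T rho).
  rewrite big_filter [RHS]big_mkcond; apply: eq_bigr => rho _ /=.
  by case: ifPn => // /count_memPn ->; rewrite muln0 mul0r.
have kn' : (0 < k.+1 <= n)%N by [].
rewrite (perm_big _ (perm_partns_ins kn')) /= big_map mulr_sumr.
rewrite !big_seq; apply: eq_bigr => rho; rewrite mem_partns => /andP[/andP[_ rho0] _].
have ps := permEl (perm_sort geq (k.+1 :: rho)).
rewrite (seq.permP ps) (Tp _ _ ps) /T big_cons /= eqxx add1n.
rewrite -(rmorph_nat phi) mulrA -rmorphM qinv_coef_cons // rmorphM.
by rewrite -!mulrA; congr (_ * _); rewrite mulrCA.
Qed.
End PartitionSum.

(** * The inverse of the generating series of the q_n *)

Section KernelSeries.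
Variables (R : comNzRingType) (q : R).

(** The coefficients of (1 - R) / (1 - q R). *)
Definition raise_coef (k : nat) : R :=
  if k is k'.+1 then q ^+ k'.+1 - q ^+ k' else 1.

(** The logarithmic derivative of (1 - R) / (1 - q R) is the difference of two
geometric series.  On coefficients the recurrence is a telescoping sum. *)
Lemma is_exp_raise_coef : is_exp (fun i => q ^+ i - 1) raise_coef.
Proof.
split=> // -[|m]; first by rewrite mul0r /conv big_ord1 expr0 subrr mul0r.
rewrite /conv big_ord_recl expr0 subrr mul0r add0r big_ord_recr /=.
rewrite subnn mulr1 (eq_bigr (fun i : 'I_m =>
    (q ^+ m.+1 - q ^+ m) - (q ^+ (m - i) - q ^+ (m - i).-1))) => [|i _].
  rewrite big_split /= sumr_const card_ord sumrN.
  have -> : \sum_(i < m) (q ^+ (m - i) - q ^+ (m - i).-1) = q ^+ m - 1.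
    rewrite (reindex_inj rev_ord_inj) /=.
    transitivity (\sum_(0 <= i < m) (q ^+ i.+1 - q ^+ i)); last first.
      by rewrite (telescope_sumr (fun i => q ^+ i)) // expr0.
    rewrite big_mkord; apply: eq_bigr => i _.
    by rewrite subKn ?(ltnW (ltn_ord i)) //; congr (_ - q ^+ _); rewrite -subnS subKn.
  by rewrite mulr_natl mulrSr -addrA; congr (_ + _); rewrite opprB addrC addrA subrK.
case: i => i /= im; rewrite /bump /= !add1n subSS -subnS -(subnSK im) /=.
move: (subnKC im); set r := (m - i.+1)%N => <-.
by rewrite mulrBl mul1r mulrBr -!exprD addnS.
Qed.
End KernelSeries.

Definition raise_coef_t (k : nat) : Qt := raise_coef t k.

Lemma is_exp_raise_coef_t : is_exp (fun i => t ^+ i - 1) raise_coef_t.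
Proof. exact: is_exp_raise_coef. Qed.

Lemma coef_qlog N i : (i <= N)%N ->
  (qlog N)`_i = if i == 0%N then 0 else ((1 - t ^+ i) / i%:R) *: psum i.
Proof.
move=> iN; rewrite /qlog coef_sum.
under eq_bigr do rewrite coefZ coefXn.
case: i iN => [|i] iN /=.
  by rewrite big_nat big1 // => -[|k] // _; rewrite mulr0.
rewrite (bigD1_seq i.+1) ?mem_index_iota ?iota_uniq ?ltnS //= eqxx mulr1.
by rewrite big1 ?addr0 // => k; rewrite eq_sym => /negPf ->; rewrite mulr0.
Qed.

Lemma is_exp_qfun : is_exp (fun i => (1 - t ^+ i) *: psum i) qfun.
Proof.
have [q0 qS] := @is_exp_exp_coef Qt symfun _ qlog Qt_natr_neq0 (erefl _) coef_qlog.
split=> // n; rewrite qS; apply: eq_conv => // i _ /=.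
case: i => [|i] /=; first by rewrite expr0 subrr scale0r mul0r.
by rewrite mulr_natl -scaler_nat scalerA mulrCA mulfV ?mulr1 ?Qt_natr_neq0.
Qed.

(** The coefficient E_s of z^s in 1 / q(z). *)
Definition qinv s : symfun := \sum_(rho <- partns s) qinv_coef rho *: ppart rho.

Lemma qinvE : qinv =1 part_sum (in_alg symfun) psum.
Proof.
by move=> s; apply: eq_bigr => rho _; rewrite /= -scalerAl mul1r.
Qed.

(** The image of p_mu under the translation p_x |-> p_x + X^x; its coefficients are
the images of p_mu under the adjoints of the q_n. *)
Definition skew_gen (mu : seq nat) : {poly symfun} :=
  \prod_(x <- mu) ((psum x)%:P + 'X^x).

Lemma skew_gen_perm la mu : perm_eq la mu -> skew_gen la = skew_gen mu.
Proof. by move=> h; apply: perm_big. Qed.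

Lemma ppart_perm la mu : perm_eq la mu -> ppart la = ppart mu.
Proof. by move=> h; apply: perm_big. Qed.

Lemma lreg_natr (A : comNzRingType) (phi : {rmorphism Qt -> A}) n :
  GRing.lreg (n.+1%:R : A).
Proof.
have inv1 : phi n.+1%:R^-1 * n.+1%:R = 1.
  by rewrite -(rmorph_nat phi) -rmorphM mulVf ?rmorph1 ?Qt_natr_neq0.
by move=> x y /(congr1 ( *%R (phi n.+1%:R^-1))); rewrite !mulrA inv1 !mul1r.
Qed.

(** The translation p_x |-> p_x + X^x multiplies the series 1 / q(z) by
(1 - X z) / (1 - t X z).  Both sides are exponentials, the left one of
- sum_k (1 - t^k) / k (p_k + X^k) z^k, and this sum splits into the one for the
raising operator and the one for 1 / q(z). *)
Lemma sum_qinv_coef_skew_gen s :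
  \sum_(rho <- partns s) (qinv_coef rho)%:A%:P * skew_gen rho =
    \sum_(k < s.+1) (raise_coef_t k *: qinv (s - k))%:P * 'X^k.
Proof.
pose phi : {rmorphism Qt -> {poly symfun}} := polyC \o in_alg symfun.
have h1 := is_exp_part_sum phi (fun k => (psum k)%:P + 'X^k).
have h2 := is_exp_powers 'X (is_exp_rmorph phi is_exp_raise_coef_t).
have h3 : is_exp (fun i => phi (t ^+ i - 1) * (psum i)%:P) (fun k => (qinv k)%:P).
  have [e0 eS] := is_exp_rmorph (@polyC symfun) (is_exp_part_sum (in_alg symfun) psum).
  split=> [|n]; first by rewrite qinvE.
  rewrite qinvE; apply: etrans (eS n) _; apply: eq_conv => i _ /=.
    by rewrite polyCM.
  by rewrite qinvE.
have h4 := is_exp_conv h2 h3.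
have h1' : is_exp (fun i => phi (t ^+ i - 1) * 'X^i + phi (t ^+ i - 1) * (psum i)%:P)
   (part_sum phi (fun k => (psum k)%:P + 'X^k)).
  have [? hS] := h1; split=> // n; rewrite hS; apply: eq_conv => // i _.
  by rewrite mulrDr addrC.
have := is_exp_uniq (lreg_natr phi) _ h1' h4 s.
rewrite /part_sum => ->; last by rewrite subrr rmorph0 !mul0r addr0.
apply: eq_bigr => k _ /=.
rewrite -[raise_coef_t k *: _]mul1r -scalerAr scalerAl polyCM -!mulrA.
by congr (_ * _); rewrite mulrC.
Qed.

(** * The Hall form on power sums *)

(** The span of the power sum products, on which the Hall form is determined. *)
Inductive pspan : symfun -> Prop :=
| pspan_ppart la : 0%N \notin la -> pspan (ppart la)
| pspan0 : pspan 0
| pspanD f g : pspan f -> pspan g -> pspan (f + g)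
| pspanZ (c : Qt) f : pspan f -> pspan (c *: f).

Lemma pspan_sum (I : Type) (r : seq I) (P : pred I) (F : I -> symfun) :
  (forall i, P i -> pspan (F i)) -> pspan (\sum_(i <- r | P i) F i).
Proof. by move=> h; apply: big_ind => //; [apply: pspan0 | apply: pspanD]. Qed.

Lemma ppart_cat la mu : ppart (la ++ mu) = ppart la * ppart mu.
Proof. exact: big_cat. Qed.

Lemma pspanM f g : pspan f -> pspan g -> pspan (f * g).
Proof.
move=> hf hg; elim: hf => [la la0||f1 f2 _ h1 _ h2|c f1 _ h1].
- elim: hg => [mu mu0||g1 g2 _ h1 _ h2|c g1 _ h1].
  + by rewrite -ppart_cat; apply: pspan_ppart; rewrite mem_cat negb_or la0.
  + by rewrite mulr0; apply: pspan0.
  + by rewrite mulrDr; apply: pspanD.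
  + by rewrite -scalerAr; apply: pspanZ.
- by rewrite mul0r; apply: pspan0.
- by rewrite mulrDl; apply: pspanD.
- by rewrite -scalerAl; apply: pspanZ.
Qed.

Lemma pspan1 : pspan 1.
Proof. by have := @pspan_ppart [::]; rewrite /ppart big_nil; apply. Qed.

Lemma pspan_psum k : pspan (psum k).
Proof.
case: k => [|k]; first exact: pspan1.
by have := @pspan_ppart [:: k.+1]; rewrite /ppart big_seq1; apply.
Qed.

(** The recurrence expresses q_n through p_1, ..., p_n. *)
Lemma pspan_qfun n : pspan (qfun n).
Proof.
have [q0 qS] := is_exp_qfun; elim/ltn_ind: n => -[|n] IH.
  by rewrite q0; apply: pspan1.
have -> : qfun n.+1 = (n.+1%:R^-1 : Qt) *: (n.+1%:R * qfun n.+1).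
  by rewrite mulr_natl -scaler_nat scalerA mulVf ?scale1r ?Qt_natr_neq0.
apply: pspanZ; rewrite qS; apply: pspan_sum => -[[|i] /= lti] _.
  by rewrite subrr scale0r mul0r; apply: pspan0.
rewrite -scalerAl; apply: pspanZ; apply: pspanM; first exact: (pspan_psum i.+1).
by apply: IH; rewrite ltnS subSS leq_subr.
Qed.

Lemma pspan_qint a : pspan (qint a).
Proof. by case: a => n; [apply: pspan_qfun | apply: pspan0]. Qed.

Lemma pspan_coef_skew_gen mu n : pspan (skew_gen mu)`_n.
Proof.
rewrite /skew_gen; elim: mu n => [|x mu IH] n.
  by rewrite big_nil coef1; case: eqP => _; [apply: pspan1 | apply: pspan0].
rewrite big_cons mulrDl coefD coefCM coefXnM; apply: pspanD.
  by apply: pspanM (IH _); apply: pspan_psum.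
by case: ifP => _; [apply: pspan0 | apply: IH].
Qed.

Lemma coef0_skew_gen mu : 0%N \notin mu -> (skew_gen mu)`_0 = ppart mu.
Proof.
elim: mu => [|x mu IH]; first by rewrite /skew_gen /ppart !big_nil coef1.
rewrite inE negb_or eq_sym -lt0n => /andP[x0 /IH].
rewrite /skew_gen /ppart !big_cons mulrDl coefD coefCM => ->.
by rewrite coefXnM x0 addr0.
Qed.

Lemma skew_gen_cons x mu : skew_gen (x :: mu) = ((psum x)%:P + 'X^x) * skew_gen mu.
Proof. exact: big_cons. Qed.

(** The Leibniz rule; a part x is removed wherever X^x has been differentiated. *)
Lemma euler_skew_gen mu : 0%N \notin mu ->
  'X * (skew_gen mu)^`() = \sum_(x <- mu) 'X^x * skew_gen (rem x mu) *+ x.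
Proof.
elim: mu => [|y mu IH].
  by rewrite big_nil /skew_gen big_nil -polyC1 derivC mulr0.
rewrite inE negb_or eq_sym -lt0n => /andP[y0 /IH {}IH].
have rem_y : rem y (y :: mu) = mu by rewrite /= eqxx.
rewrite [RHS]big_cons rem_y skew_gen_cons derivM mulrDr derivD derivC add0r derivXn.
rewrite (mulrCA 'X _ (_^`())) IH; congr (_ + _).
  by rewrite mulrA mulrnAr -exprS prednK // mulrnAl.
rewrite mulr_sumr !big_seq.
apply: eq_bigr => x xmu; rewrite mulrnAr mulrCA; congr (_ * _ *+ _).
rewrite -skew_gen_cons; apply: skew_gen_perm => /=.
by case: eqP => [->|//]; rewrite perm_sym perm_to_rem.
Qed.

(** Coefficients of negative degree are zero, as are the q_n with n < 0. *)
Definition int_coef (P : {poly symfun}) (a : int) : symfun :=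
  if a is Posz n then P`_n else 0.

Lemma pspan_int_coef mu a : pspan (int_coef (skew_gen mu) a).
Proof. by case: a => n; [apply: pspan_coef_skew_gen | apply: pspan0]. Qed.

Lemma int_coef_sub P a k : int_coef P (a - k%:Z) = int_coef ('X^k * P) a.
Proof.
case: a => n /=; last by rewrite NegzE -opprD -[n.+1%:Z + k]/((n.+1 + k)%N%:Z).
rewrite coefXnM; case: ltnP => [nk|kn]; last by rewrite subzn.
by rewrite -opprB subzn ?(ltnW nk) // -(subnSK nk).
Qed.

(** The action on p_mu E_s of the adjoint of q_x: a translation is multiplicative,
so the contributions of p_mu and of E_s multiply. *)
Lemma sum_qinv_coef_int_coef mu x s :
  \sum_(rho <- partns s) qinv_coef rho *: int_coef (skew_gen (mu ++ rho)) x =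
    \sum_(k < s.+1)
      raise_coef_t k *: (int_coef (skew_gen mu) (x - k%:Z) * qinv (s - k)).
Proof.
case: x => n; last first.
  rewrite !big1 // => [k _|rho _]; last by rewrite scaler0.
  by rewrite int_coef_sub mul0r scaler0.
transitivity ((skew_gen mu *
    \sum_(rho <- partns s) (qinv_coef rho)%:A%:P * skew_gen rho)`_n).
  rewrite mulr_sumr coef_sum; apply: eq_bigr => rho _ /=.
  by rewrite mulrCA coefCM -scalerAl mul1r /skew_gen big_cat.
rewrite sum_qinv_coef_skew_gen mulr_sumr coef_sum; apply: eq_bigr => k _.
by rewrite int_coef_sub mulrCA coefCM mulrC (mulrC _ 'X^k) -scalerAr.
Qed.

(** The series (1 - R) / (1 - t R) applied to q_x, with R lowering the index and
with X counting how often: X stands for the raising of the first index. *)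
Definition shift_poly N (x : int) : {poly symfun} :=
  \poly_(k < N.+1) (raise_coef_t k *: qint (x - k%:Z)).

Lemma pspan_coef_prod_shift N xs k : pspan (\prod_(x <- xs) shift_poly N x)`_k.
Proof.
elim: xs k => [|y ys IHy] k.
  by rewrite big_nil coef1; case: eqP => _; [apply: pspan1 | apply: pspan0].
rewrite big_cons coefM; apply: pspan_sum => i _; apply: pspanM (IHy _).
rewrite coef_poly; case: ifP => _; last exact: pspan0.
exact/pspanZ/pspan_qint.
Qed.

Section Form.
Variables (B : {biscalar symfun}) (hB : is_hall_form B).

Lemma hallZl (c : Qt) f g : B (c *: f) g = c * B f g.
Proof. exact: linearZl_LR. Qed.

Lemma hallZr (c : Qt) f g : B f (c *: g) = c * B f g.
Proof. exact: linearZr_LR. Qed.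

Lemma hall0r f : B f 0 = 0. Proof. exact: linear0r. Qed.
Lemma hall0l f : B 0 f = 0. Proof. exact: linear0l. Qed.
Lemma hallDl f g h : B (f + g) h = B f h + B g h. Proof. exact: linearDl. Qed.
Lemma hallDr f g h : B h (f + g) = B h f + B h g. Proof. exact: linearDr. Qed.

Lemma hall_suml (I : Type) (r : seq I) (P : pred I) (E : I -> symfun) g :
  B (\sum_(i <- r | P i) E i) g = \sum_(i <- r | P i) B (E i) g.
Proof. exact: linear_sumlz. Qed.

Lemma hall_sumr (I : Type) (r : seq I) (P : pred I) (E : I -> symfun) f :
  B f (\sum_(i <- r | P i) E i) = \sum_(i <- r | P i) B f (E i).
Proof. exact: linear_sumr. Qed.

Lemma hall_ppart la mu : 0%N \notin la -> 0%N \notin mu ->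
  B (ppart la) (ppart mu) = if perm_eq la mu then zt la else 0.
Proof.
move=> la0 mu0.
have psort (s : seq nat) := permEl (perm_sort geq s).
rewrite -(ppart_perm (psort la)) -(ppart_perm (psort mu)) hB ?is_part_sort //.
rewrite -is_part_perm_eq ?is_part_sort // (zt_perm (psort la)).
by rewrite (permPl (psort la)) (permPr (psort mu)).
Qed.

(** The adjoint of multiplication by p_k is k / (1 - t^k) d/dp_k; the derivative of
p_mu is written as a sum over the occurrences of k in mu. *)
Lemma hall_psum k f mu : (0 < k)%N -> 0%N \notin mu -> pspan f ->
  B (psum k * f) (ppart mu) =
    \sum_(x <- mu | x == k) k%:R / (1 - t ^+ k) * B f (ppart (rem x mu)).
Proof.
move=> k0 mu0; elim=> [la la0||f1 f2 _ h1 _ h2|c f1 _ h1]; last first.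
- rewrite -scalerAr hallZl h1 mulr_sumr; apply: eq_bigr => x _.
  by rewrite hallZl mulrCA.
- rewrite mulrDr hallDl h1 h2 -big_split; apply: eq_bigr => x _ /=.
  by rewrite hallDl mulrDr.
- rewrite mulr0 hall0l big1 // => x _; by rewrite hall0l mulr0.
have -> : psum k * ppart la = ppart (k :: la) by rewrite /ppart big_cons.
rewrite hall_ppart //; last by rewrite inE negb_or eq_sym -lt0n k0.
rewrite (eq_bigr (fun=> k%:R / (1 - t ^+ k) * B (ppart la) (ppart (rem k mu))));
  last by move=> x /eqP ->.
rewrite big_const_seq iter_addr_0 hall_ppart //; last first.
  exact: contra (@mem_rem _ k mu _) mu0.
have [kmu|kmu] := boolP (k \in mu); last first.
  rewrite ifN; last by apply: contra kmu => /perm_mem <-; apply: mem_head.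
  by rewrite (count_memPn kmu) mulr0n.
rewrite (permPr (perm_to_rem kmu)) perm_cons; case: ifP => [lamu|_]; last first.
  by rewrite mulr0 mul0rn.
rewrite zt_cons (seq.permP (perm_to_rem kmu)) /= eqxx add1n (seq.permP lamu).
move: (zt la) => z.
by rewrite -[RHS]mulr_natr -!mulrA; congr (_ * _); rewrite mulrC mulrA.
Qed.

(** By induction on n: the recurrence for q_n brings out one factor p_k, whose
adjoint removes a part k of mu.  The same recurrence holds for the
coefficients of the translated product, by Euler's identity. *)
Lemma hall_qfun n f mu : 0%N \notin mu -> pspan f ->
  B (qfun n * f) (ppart mu) = B f (skew_gen mu)`_n.
Proof.
have [q0 qS] := is_exp_qfun.
elim/ltn_ind: n mu => -[|n] IH mu mu0 hf; first by rewrite q0 mul1r coef0_skew_gen.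
apply: (mulfI (Qt_natr_neq0 n)).
have qS' : (n.+1%:R : Qt) *: qfun n.+1 =
    conv (fun i => (1 - t ^+ i) *: psum i) qfun n.+1.
  by rewrite -qS mulr_natl scaler_nat.
rewrite -hallZl scalerAl qS' mulr_suml hall_suml.
have -> : n.+1%:R * B f (skew_gen mu)`_n.+1 =
    \sum_(x <- mu) \sum_(i < n.+2 | x == i)
      x%:R * B f (skew_gen (rem x mu))`_(n.+1 - x).
  rewrite -hallZr scaler_nat -coef_deriv.
  have -> : (skew_gen mu)^`()`_n = ('X * (skew_gen mu)^`())`_n.+1 by rewrite coefXM.
  rewrite euler_skew_gen // coef_sum hall_sumr; apply: eq_bigr => x _.
  rewrite coefMn coefXnM -scaler_nat hallZr.
  have [xn|nx] := ltnP n.+1 x.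
    rewrite hall0r mulr0 big1 // => i /eqP xi.
    by move: xn; rewrite xi ltnNge leq_ord.
  by rewrite (big_pred1 (Ordinal (nx : (x < n.+2)%N))) // => i; rewrite eq_sym.
rewrite (exchange_big_dep predT) //=; apply: eq_bigr => -[i /= ltin] _.
case: i ltin => [|i] ltin.
  rewrite subrr scale0r !mul0r hall0l big1_seq // => x /andP[/eqP -> xmu].
  by rewrite xmu in mu0.
rewrite -scalerAl -scalerAl -mulrA hallZl hall_psum //; last first.
  by apply: pspanM hf; apply: pspan_qfun.
rewrite mulr_sumr [LHS]big_seq_cond [RHS]big_seq_cond.
apply: eq_bigr => x /andP[xmu /eqP xi].
rewrite IH ?xi //.
- rewrite mulrA; congr (_ * _).
  by rewrite mulrCA mulfV ?mulr1 // subr1tX_neq0.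
- by rewrite ltnS subSS leq_subr.
- exact: contra (@mem_rem _ _ mu _) mu0.
Qed.

Lemma hall_qint a f mu : 0%N \notin mu -> pspan f ->
  B (qint a * f) (ppart mu) = B f (int_coef (skew_gen mu) a).
Proof.
by case: a => n mu0 hf /=; [apply: hall_qfun | rewrite mul0r hall0l hall0r].
Qed.

(** Induction on xs, moving the first factor to the other side.  On the left this
is the adjoint of q_(x-k) applied to g, weighted by the k-th coefficient of
the raising operator; on the right it is the adjoint of q_x applied to g E_s,
which is the sum of the same terms. *)
Lemma hall_prod_shift N xs s g : (s <= N)%N -> pspan g ->
  B (\prod_(x <- xs) shift_poly N x)`_s g = B (\prod_(x <- xs) qint x) (g * qinv s).
Proof.
elim: xs s g => [|x xs IH] s g sN; elim=> [mu mu0||f1 f2 _ h1 _ h2|c f1 _ h1];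
  do ?by [rewrite mul0r !hall0r | rewrite mulrDl !hallDr h1 h2
         | rewrite -scalerAl !hallZr h1].
  rewrite !big_nil coef1 /qinv mulr_sumr hall_sumr.
  have p1 : ppart [::] = 1 by rewrite /ppart big_nil.
  (* Without factors only degree 0 survives: 1 is orthogonal to all p_rho with rho
     nonempty. *)
  case: s sN => [|s] sN.
    by rewrite (perm_big _ partns0) big_seq1 qinv_coef0 scale1r p1 mulr1.
  rewrite hall0l big_seq big1 // => rho; rewrite mem_partns.
  move=> /andP[/andP[_ rho0] /eqP srho].
  rewrite -scalerAr hallZr -ppart_cat -p1 hall_ppart ?mem_cat ?negb_or ?mu0 //.
  case: ifP => [/perm_size|]; last by rewrite mulr0.
  by case: rho srho {rho0} => [//|y rho] _; rewrite size_cat /= addnS.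
rewrite !big_cons coefM hall_suml.
have hq : pspan (\prod_(x <- xs) qint x).
  by apply: big_ind => [|f h|i _]; [apply: pspan1 | apply: pspanM | apply: pspan_qint].
have hP := pspan_coef_prod_shift N xs.
transitivity (\sum_(k < s.+1) B (\prod_(x <- xs) qint x)
    (raise_coef_t k *: (int_coef (skew_gen mu) (x - k%:Z) * qinv (s - k)))).
  apply: eq_bigr => k _; have ks := leq_ord k.
  rewrite coef_poly ltnS (leq_trans ks sN) -scalerAl hallZl hallZr hall_qint //.
  by rewrite IH ?(leq_trans (leq_subr _ _)) //; apply: pspan_int_coef.
rewrite -hall_sumr -sum_qinv_coef_int_coef hall_sumr /qinv mulr_sumr hall_sumr.
rewrite [LHS]big_seq [RHS]big_seq; apply: eq_bigr => rho.
rewrite mem_partns => /andP[/andP[_ rho0] _].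
rewrite -scalerAr !hallZr -ppart_cat hall_qint //.
by rewrite mem_cat negb_or mu0.
Qed.
End Form.

(** * Raising operators *)

Section RaisingOperators.
Variable l : nat.
Implicit Types (g : ('I_l -> int) -> symfun) (a : 'I_l -> int).

Definition raise_seq N (s : seq ('I_l * 'I_l)) g : ('I_l -> int) -> symfun :=
  foldr (fun ij g' => raise_factor N ij.1 ij.2 g') g s.

(** Explicit indices, from which commutation of the raising operators is plain
arithmetic. *)
Lemma iter_raiseE k i j a x :
  iter k (raise i j) a x = a x + (k * (x == i))%N%:Z - (k * (x == j))%N%:Z.
Proof. by elim: k => [|k IH] /=; rewrite ?mul0n /raise ?IH; lia. Qed.

Lemma iter_raiseC k i j m p q a :
  iter k (raise i j) (iter m (raise p q) a) =
    iter m (raise p q) (iter k (raise i j) a).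
Proof. by apply: functional_extensionality_dep => x; rewrite !iter_raiseE; lia. Qed.

Lemma raise_factorE N i j g a :
  raise_factor N i j g a = \sum_(k < N.+1) raise_coef_t k *: g (iter k (raise i j) a).
Proof.
rewrite big_ord_recl /= scale1r; congr (_ + _).
by rewrite big_add1 big_mkord.
Qed.

Lemma raise_factorC N i j p q g :
  raise_factor N i j (raise_factor N p q g) =
    raise_factor N p q (raise_factor N i j g).
Proof.
apply: functional_extensionality_dep => a; rewrite !raise_factorE.
under eq_bigr do rewrite raise_factorE scaler_sumr.
under [RHS]eq_bigr do rewrite raise_factorE scaler_sumr.
rewrite exchange_big /=; apply: eq_bigr => m _; apply: eq_bigr => k _.
by rewrite iter_raiseC !scalerA mulrC.
Qed.

Lemma raise_seqC N s1 s2 g :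
  raise_seq N s1 (raise_seq N s2 g) = raise_seq N s2 (raise_seq N s1 g).
Proof.
elim: s1 => //= ij s1 ->; elim: s2 => //= pq s2 IH.
by rewrite raise_factorC IH.
Qed.

Lemma raise_seq_perm N s1 s2 g :
  perm_eq s1 s2 -> raise_seq N s1 g = raise_seq N s2 g.
Proof.
pose P s := raise_seq N s1 g = raise_seq N s g.
move=> s12; apply: (catCA_perm_ind (P := P)) s12 _ => //.
by rewrite /P => u v w ->; rewrite /raise_seq !foldr_cat [LHS]raise_seqC.
Qed.

(** No operator R_ij with i < j increases these sums. *)
Definition tailsum (p : 'I_l) a : int := \sum_(x < l | (p <= x)%N) a x.

Definition tail_null g := forall a p, tailsum p a < 0 -> g a = 0.

Lemma tail_null_qprod : tail_null (@qprod l).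
Proof.
move=> a p neg; have /existsP[x ax] : [exists x, a x < 0].
  apply: contraLR neg => /existsPn nonneg; rewrite -leNgt.
  by apply: sumr_ge0 => x _; rewrite leNgt.
rewrite /qprod (bigD1 x) //=; case: (a x) ax => //= n _; exact: mul0r.
Qed.

Lemma tailsum_raise p k i j a :
  tailsum p (iter k (raise i j) a) =
    tailsum p a + (k * (p <= i))%N%:Z - (k * (p <= j))%N%:Z.
Proof.
have delta (y : 'I_l) :
    \sum_(x < l | (p <= x)%N) (k * (x == y))%N%:Z = (k * (p <= y))%N%:Z.
  rewrite big_mkcond (bigD1 y) //= eqxx big1 ?addr0 => [|x /negPf ->].
    by case: ifP; rewrite ?muln1 ?muln0.
  by rewrite muln0 if_same.
rewrite /tailsum (eq_bigr _ (fun x _ => iter_raiseE k i j a x)).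
by rewrite !big_split /= sumrN !delta.
Qed.

(** A negative tail sum stays negative when further operators are applied. *)
Lemma tail_null_raise_seq N s g :
  all (fun ij : 'I_l * 'I_l => (ij.1 < ij.2)%N) s ->
  tail_null g -> tail_null (raise_seq N s g).
Proof.
move=> + gnull; elim: s => //= -[i j] s IH /= /andP[ij /IH {}IH] a p neg.
rewrite raise_factorE big1 // => k _; rewrite (IH _ p) ?scaler0 //.
rewrite tailsum_raise; have : (p <= i -> p <= j)%N by lia.
lia.
Qed.

(** The operator R_ij lowers the tail sum at j by one.  After more than M
applications that sum is negative, and it remains so. *)
Lemma raise_seq_trunc M N s g a : (M <= N)%N ->
  all (fun ij : 'I_l * 'I_l => (ij.1 < ij.2)%N) s -> tail_null g ->
  (forall p, tailsum p a <= M%:Z) -> raise_seq N s g a = raise_seq M s g a.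
Proof.
move=> MN + gnull; elim: s a => //= -[i j] s IH a /= /andP[ij sok] aM.
rewrite !raise_factorE.
rewrite [RHS](big_ord_widen N.+1 (fun k =>
  raise_coef_t k *: raise_seq M s g (iter k (raise i j) a))) //.
rewrite [RHS]big_mkcond; apply: eq_bigr => k _ /=.
case: ltnP => kM.
  rewrite IH // => p; rewrite tailsum_raise; have := aM p.
  have : (p <= i -> p <= j)%N by lia.
  lia.
rewrite (@tail_null_raise_seq N s g sok gnull _ j) ?scaler0 //.
by rewrite tailsum_raise leqnn leqNgt ij /= muln0 muln1; have := aM j; lia.
Qed.

End RaisingOperators.

(** The linear map sending X^s to q_(m+s): it converts powers of X back into
raisings of the first index. *)
Definition q_pairing (m : int) (P : {poly symfun}) : symfun :=
  \sum_(s < size P) P`_s * qint (m + s%:Z).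

Lemma q_pairingE M m (P : {poly symfun}) : (size P <= M)%N ->
  q_pairing m P = \sum_(s < M) P`_s * qint (m + s%:Z).
Proof.
move=> PM; rewrite /q_pairing (big_ord_widen M (fun s => P`_s * qint (m + s%:Z))) //.
rewrite big_mkcond; apply: eq_bigr => s _ /=.
by case: ltnP => // sP; rewrite nth_default ?mul0r.
Qed.

Lemma q_pairingD m (P Q : {poly symfun}) :
  q_pairing m (P + Q) = q_pairing m P + q_pairing m Q.
Proof.
have PM := leq_maxl (size P) (size Q); have QM := leq_maxr (size P) (size Q).
rewrite (q_pairingE m (size_polyD P Q)) (q_pairingE m PM) (q_pairingE m QM).
rewrite -big_split.
by apply: eq_bigr => s _; rewrite coefD mulrDl.
Qed.

Lemma q_pairing0 m : q_pairing m 0 = 0.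
Proof. by rewrite /q_pairing size_poly0 big_ord0. Qed.

Lemma q_pairing_sum m (I : Type) (r : seq I) (P : pred I) (F : I -> {poly symfun}) :
  q_pairing m (\sum_(i <- r | P i) F i) = \sum_(i <- r | P i) q_pairing m (F i).
Proof. exact: (big_morph _ (q_pairingD m) (q_pairing0 m)). Qed.

Lemma q_pairingC m c (P : {poly symfun}) :
  q_pairing m (c%:P * P) = c * q_pairing m P.
Proof.
have cP : (size (c%:P * P)%R <= size P)%N by rewrite mul_polyC size_scale_leq.
rewrite (q_pairingE m cP) mulr_sumr; apply: eq_bigr => s _.
by rewrite coefCM mulrA.
Qed.

Lemma q_pairingXn m k (P : {poly symfun}) :
  q_pairing m ('X^k * P) = q_pairing (m + k%:Z) P.
Proof.
have sP : (size ('X^k * P)%R <= k + size P)%N.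
  by apply: leq_trans (size_polyMleq _ _) _; rewrite size_polyXn.
rewrite (q_pairingE m sP) big_split_ord /= big1 ?add0r => [|s _]; last first.
  by rewrite coefXnM ltn_ord mul0r.
apply: eq_bigr => s _.
by rewrite coefXnM ltnNge leq_addr /= addKn PoszD addrA.
Qed.

Lemma q_pairingZXn m k (c : symfun) (P : {poly symfun}) :
  q_pairing m (c *: 'X^k * P) = c * q_pairing (m + k%:Z) P.
Proof. by rewrite -mul_polyC -[_ * _ * P]mulrA q_pairingC q_pairingXn. Qed.

(** The operators R_0j act on independent indices j and share the index 0, where
their effects add up.  The expansion is thus a product of polynomials in X, read
off by q_pairing. *)
Lemma raise_first_qprod l N (js : seq 'I_l) (a : 'I_l.+1 -> int) : uniq js ->
  raise_seq N [seq (ord0, lift ord0 j) | j <- js] (@qprod l.+1) a =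
    q_pairing (a ord0) (\prod_(i < l)
      if i \in js then shift_poly N (a (lift ord0 i))
      else (qint (a (lift ord0 i)))%:P).
Proof.
elim: js a => [|j js IH] a /=.
  transitivity (q_pairing (a ord0)
      ((\prod_(i < l) qint (a (lift ord0 i)))%:P * 1)).
    rewrite q_pairingC (@q_pairingE 1) ?size_poly1 // big_ord1 coef1.
    rewrite mul1r addr0 mulrC; exact: big_ord_recl.
  by rewrite mulr1 rmorph_prod.
move=> /andP[jjs ujs]; rewrite raise_factorE.
rewrite [in RHS](bigD1 j) //= mem_head.
under eq_bigr do rewrite IH //.
rewrite (_ : shift_poly N (a (lift ord0 j)) =
  \sum_(k < N.+1) (raise_coef_t k *: qint (a (lift ord0 j) - k%:Z)) *: 'X^k);
  last exact: poly_def.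
rewrite mulr_suml q_pairing_sum; apply: eq_bigr => k _.
rewrite [in LHS](bigD1 j) //= (negPf jjs) !iter_raiseE.
rewrite q_pairingZXn -scalerAl; congr (_ *: _).
have l0 (x : 'I_l) : (lift ord0 x == ord0) = false by [].
rewrite q_pairingC; congr (qint _ * q_pairing _ _).
- by rewrite l0 eqxx; lia.
- by rewrite eqxx (eq_sym ord0) l0; lia.
apply: eq_bigr => i ij; rewrite inE (negPf ij) /= iter_raiseE.
have -> : a (lift ord0 i) + (k * (lift ord0 i == ord0))%N%:Z
   - (k * (lift ord0 i == lift ord0 j))%N%:Z = a (lift ord0 i).
  by rewrite (inj_eq lift_inj) (negPf ij) l0; lia.
by [].
Qed.

(** Operators that leave the first index alone carry over any relation between
their arguments that is linear and only depends on that index. *)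
Lemma raise_seq_lift l N (s : seq ('I_l * 'I_l)) (B : {biscalar symfun})
    (u v : symfun) m (g : ('I_l.+1 -> int) -> symfun) (h : ('I_l -> int) -> symfun) :
  (forall a, a ord0 = m -> B (g a) u = B (h (fun i => a (lift ord0 i))) v) ->
  forall a, a ord0 = m ->
    B (raise_seq N [seq (lift ord0 ij.1, lift ord0 ij.2) | ij <- s] g a) u =
    B (raise_seq N s h (fun i => a (lift ord0 i))) v.
Proof.
move=> gh; elim: s => //= -[i j] s IH a am /=.
rewrite !raise_factorE !hall_suml; apply: eq_bigr => k _.
rewrite !hallZl IH /=; last by rewrite iter_raiseE am /=; lia.
congr (_ * B (raise_seq _ _ _ _) _); apply: functional_extensionality_dep => x.
by rewrite !iter_raiseE !(inj_eq lift_inj).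
Qed.

Definition increasing_pairs l : seq ('I_l * 'I_l) :=
  [seq ij : 'I_l * 'I_l <- enum {: 'I_l * 'I_l} | (ij.1 < ij.2)%N].

(** Listed first, the pairs with a positive first entry act last. *)
Lemma perm_increasing_pairs l :
  perm_eq (increasing_pairs l.+1)
    ([seq (lift ord0 ij.1, lift ord0 ij.2) | ij <- increasing_pairs l]
     ++ [seq (ord0, lift ord0 j) | j <- enum 'I_l]).
Proof.
apply: uniq_perm.
- exact/filter_uniq/enum_uniq.
- rewrite cat_uniq; apply/and3P; split.
  + rewrite map_inj_uniq; first exact/filter_uniq/enum_uniq.
    move=> [i j] [i' j'] /=.
    move=> /eqP; rewrite xpair_eqE !(inj_eq lift_inj) /=.
    by move=> /andP[/eqP -> /eqP ->].
  + by apply/hasPn => _ /mapP[j _ ->]; apply/mapP => -[[x y] _ /eqP].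
  + rewrite map_inj_uniq ?enum_uniq // => i j /eqP.
    by rewrite xpair_eqE (inj_eq lift_inj) => /andP[_ /eqP].
move=> ij; rewrite mem_filter mem_enum andbT mem_cat; apply/idP/orP.
  case: ij => i j /=.
  case: (unliftP ord0 j) => [j'|] -> //.
  case: (unliftP ord0 i) => [i'|] -> ij.
    left; apply/mapP; exists (i', j') => //.
    by rewrite mem_filter mem_enum andbT.
  by right; apply/mapP; exists j'; rewrite ?mem_enum.
case=> /mapP[].
  by move=> [i' j'] + ->; rewrite mem_filter mem_enum andbT.
by move=> j' _ ->.
Qed.

(** * Removing the first part *)

Lemma sumn_mask_negb (b : bitseq) (mu : seq nat) : size b = size mu ->
  (sumn (mask b mu) + sumn (mask (map negb b) mu) = sumn mu)%N.
Proof.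
elim: b mu => [|x b IH] [|k mu] //= [/IH <-].
by case: x => /=; lia.
Qed.

Lemma sum_tuple_cons (V : nmodType) n (F : n.+1.-tuple bool -> V) :
  \sum_b F b = \sum_(x : bool) \sum_(b : n.-tuple bool) F [tuple of x :: b].
Proof.
rewrite pair_big /=.
rewrite (reindex (fun p : bool * n.-tuple bool => [tuple of p.1 :: p.2])) //=.
exists (fun b => (thead b, [tuple of behead b])) => [[x b] _|b _] /=.
  by congr (_, _); apply: val_inj.
by apply: val_inj; case/tupleP: b.
Qed.

(** Each factor p_x + X^x contributes p_x or X^x, that is, x belongs to the
subpartition or to its complement. *)
Lemma skew_gen_mask mu :
  skew_gen mu = \sum_(b : (size mu).-tuple bool)
               (ppart (mask b mu))%:P * 'X^(sumn (mask (map negb b) mu)).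
Proof.
elim: mu => [|k mu IH].
  rewrite (big_pred1 [tuple]) => [|b]; last by apply/esym/eqP; apply: tuple0.
  by rewrite /skew_gen /ppart /= !big_nil mulr1.
rewrite sum_tuple_cons /= big_bool /= skew_gen_cons {}IH mulrDl; congr (_ + _).
  rewrite mulr_sumr; apply: eq_bigr => b _ /=.
  by rewrite /ppart big_cons polyCM mulrA.
rewrite mulr_sumr; apply: eq_bigr => b _ /=.
by rewrite mulrCA exprD.
Qed.

Lemma coef_skew_gen_mask mu k :
  (skew_gen mu)`_k =
    \sum_(b : (size mu).-tuple bool | sumn (mask b mu) + k == sumn mu)
      ppart (mask b mu).
Proof.
rewrite skew_gen_mask coef_sum [RHS]big_mkcond; apply: eq_bigr => b _.
rewrite coefCM coefXn -(@sumn_mask_negb b mu) ?size_tuple // eqn_add2l.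
by case: eqP => _; rewrite ?mulr1 ?mulr0.
Qed.

Lemma Posz_sum (I : Type) (r : seq I) (P : pred I) (F : I -> nat) :
  (\sum_(i <- r | P i) F i)%N%:Z = \sum_(i <- r | P i) (F i)%:Z.
Proof. exact: (big_morph Posz PoszD (erefl _)). Qed.

Section Main.
Variables (B : {biscalar symfun}) (hB : is_hall_form B).

(** The sum on the right stops at N because the translate of p_mu has degree
|mu| in X.  In degree s <= N the bound N on the number of raisings is not
reached, so the truncated operators give the exact coefficients. *)
Lemma hall_q_pairing l N (a : 'I_l -> int) m mu :
  0%N \notin mu -> (sumn mu <= N)%N ->
  B (q_pairing m%:Z (\prod_(i < l) shift_poly N (a i))) (ppart mu) =
    B (qprod a) (\sum_(s < N.+1) (skew_gen mu)`_(m + s) * qinv s).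
Proof.
move=> mu0 muN; set P := \prod_i _.
have PE : P = \prod_(x <- [seq a i | i <- enum 'I_l]) shift_poly N x.
  by rewrite big_map big_enum.
have hP k : pspan P`_k by rewrite PE; apply: pspan_coef_prod_shift.
have hQ k g : (k <= N)%N -> pspan g -> B P`_k g = B (qprod a) (g * qinv k).
  by move=> kN hg; rewrite PE hall_prod_shift // big_map big_enum.
rewrite (q_pairingE _ (leq_maxl _ N.+1)) hall_suml hall_sumr.
rewrite [RHS](big_ord_widen (maxn (size P) N.+1)
  (fun s => B (qprod a) ((skew_gen mu)`_(m + s) * qinv s))) ?leq_maxr //.
rewrite [RHS]big_mkcond; apply: eq_bigr => s _ /=.
rewrite (mulrC P`_s) hall_qfun //.
case: ltnP => sN.
  by apply: hQ => //; apply: pspan_coef_skew_gen.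
rewrite coef_skew_gen_mask big1 ?hall0r // => b /eqP.
by have := @sumn_mask_negb b mu; rewrite size_tuple => /(_ erefl); lia.
Qed.

Lemma HLQ_cons m la :
  HLQ (m :: la) = raise_seq (m + sumn la)
     [seq (lift ord0 ij.1, lift ord0 ij.2) | ij <- increasing_pairs (size la)]
     (fun a => q_pairing (a ord0)
        (\prod_(i < size la) shift_poly (m + sumn la) (a (lift ord0 i))))
     (fun i => (nth 0%N (m :: la) i)%:Z).
Proof.
transitivity (raise_seq (m + sumn la) (increasing_pairs (size la).+1)
   (@qprod _) (fun i => (nth 0%N (m :: la) i)%:Z)); first by [].
rewrite (raise_seq_perm _ _ (perm_increasing_pairs _)) /raise_seq foldr_cat.
congr (foldr _ _ _ _); apply: functional_extensionality_dep => a.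
apply: etrans (raise_first_qprod _ _ (enum_uniq _)) _; congr q_pairing.
by apply: eq_bigr => i _; rewrite mem_enum.
Qed.

Lemma HLQ_trunc N la : (sumn la <= N)%N ->
  raise_seq N (increasing_pairs (size la)) (@qprod _)
    (fun i => (nth 0%N la i)%:Z) = HLQ la.
Proof.
move=> laN; apply: raise_seq_trunc => //; first exact: filter_all.
  exact: tail_null_qprod.
move=> p; rewrite sumnE (big_nth 0%N) big_mkord.
rewrite /tailsum Posz_sum [leRHS](bigID (fun x : 'I_(size la) => p <= x)%N) /=.
by rewrite lerDl sumr_ge0.
Qed.

(** For a subpartition tau, the adjoint of q_(m+s) reaches p_tau only for
s = |la| - |tau|, which collapses the sum over s. *)
Lemma green_cons m la mu : 0%N \notin mu -> sumn mu = (m + sumn la)%N ->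
  green B (m :: la) mu =
    \sum_(b : (size mu).-tuple bool | (sumn (mask b mu) <= sumn la)%N)
      B (HLQ la) (ppart (mask b mu) * qinv (sumn la - sumn (mask b mu))).
Proof.
move=> mu0 muE; set N := (m + sumn la)%N in muE.
rewrite /green HLQ_cons -/N.
rewrite (@raise_seq_lift _ _ _ B _
  (\sum_(s < N.+1) (skew_gen mu)`_(m + s) * qinv s) m%:Z _ (@qprod _)) //;
  last first.
  by move=> a ->; rewrite hall_q_pairing ?muE.
rewrite /= HLQ_trunc ?leq_addl // hall_sumr.
under [LHS]eq_bigr do rewrite coef_skew_gen_mask mulr_suml hall_sumr.
rewrite (exchange_big_dep (fun b : (size mu).-tuple bool =>
  sumn (mask b mu) <= sumn la)%N) /=.
  apply: eq_bigr => b bla.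
  have sN : (sumn la - sumn (mask b mu) < N.+1)%N by rewrite /N; lia.
  rewrite (big_pred1 (Ordinal sN)) // => s /=.
  by rewrite -val_eqE /= muE /N; apply/eqP/eqP; lia.
by move=> s b _ /eqP; rewrite muE /N; lia.
Qed.

Lemma hall_qinv la tau s :
  B (HLQ la) (ppart tau * qinv s) =
    \sum_(rho <- partns s)
      (-1) ^+ size rho / zt rho * green B la (part_union tau rho).
Proof.
rewrite /qinv mulr_sumr hall_sumr; apply: eq_bigr => rho _.
rewrite -scalerAr hallZr -ppart_cat /green /part_union.
by rewrite (ppart_perm (permEl (perm_sort _ _))).
Qed.
End Main.

Theorem theorem2p6 (B : {biscalar symfun}) (hB : is_hall_form B)
    (n : nat) (lam mu : seq nat) (hn : (1 <= n)%N)
    (hlam : is_part_of n lam) (hmu : is_part_of n mu) :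
  let lam1 := head 0%N lam in
  let lamr := behead lam in
  green B lam mu =
    \sum_(b : (size mu).-tuple bool | (sumn (mask b mu) <= n - lam1)%N)
      \sum_(rho <- partns (sumn lamr - sumn (mask b mu)))
        (-1) ^+ size rho / zt rho * green B lamr (part_union (mask b mu) rho)
  /\
  \sum_(b : (size mu).-tuple bool | (sumn (mask b mu) <= n - lam1)%N)
    \sum_(rho <- partns (sumn lamr - sumn (mask b mu)))
      (-1) ^+ size rho / zt rho * green B lamr (part_union (mask b mu) rho) =
    \sum_(0 <= i < (n - lam1).+1)
      \sum_(b : (size mu).-tuple bool | sumn (mask b mu) == i)
        \sum_(rho <- partns (n - lam1 - i))
          (-1) ^+ size rho / zt rho * green B lamr (part_union (mask b mu) rho).
Proof.
case: lam hlam => [|m la] /andP[_ /eqP lamE] /=.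
  by rewrite -lamE in hn.
case/andP: hmu => /andP[_ mu0] /eqP muE.
have laE : (n - m)%N = sumn la by rewrite -lamE addKn.
rewrite laE; split.
  rewrite green_cons ?muE //; apply: eq_bigr => b _; exact: hall_qinv.
rewrite big_mkord.
rewrite (exchange_big_dep (fun b : (size mu).-tuple bool =>
  sumn (mask b mu) <= sumn la)%N) /=.
  apply: eq_bigr => b bla.
  by rewrite (big_pred1 (Ordinal (bla : (_ < _.+1)%N))).
by move=> i b _ /eqP ->; rewrite -ltnS.
Qed.
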